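(* Let $X$ be a real data matrix with $d$ rows, whose columns are the inputs and have zero mean, and let $C=XX^T$. Let $v_1,\dots,v_d$ be orthonormal eigenvectors of $C$ with eigenvalues $\lambda_1\ge\lambda_2\ge\dots\ge\lambda_d$. Let $1\le n<d$, with $\lambda_i>0$ for $i\le n$, and put $$C_n=C-\sum_{i=1}^{n}\frac{Cv_iv_i^TC}{\lambda_i^2}.$$ Then $C_n$ is symmetric and every eigenvector $v_i$ of $C$ is an eigenvector of $C_n$, with eigenvalue $0$ if $i\le n$ and eigenvalue $\lambda_i$ if $i>n$; hence $\lambda_{n+1}$ is the largest eigenvalue of $C_n$, and $C_n$ is positive semi-definite. Consequently the problem of maximizing $w^TC_nw$ subject to $w^Tw=1$ is a convex optimization problem, and gradient ascent reaches its global optimum, except if the ascent is started at an eigenvector $v_i$ at which the gradient $C_nv_i$ vanishes. For random starting vectors the probability of this exception is zero.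
   Context: The matrix $C=XX^T$ is called the correlation matrix of the data, and $v_1,\dots,v_n$ are the principal components already computed. With $y=X^Tw$ and $y_i=X^Tv_i$, the vector $C_nw$ is the gradient with respect to $w$ of the objective $f_n(w)=\frac{y^Ty}{2}-\sum_{i=1}^{n}\frac{(y^Ty_i)^2}{2\lambda_i^2}$, so that $f_n(w)=\frac12 w^TC_nw$. Gradient ascent means taking steps in $w$ along this gradient, with the constraint $w^Tw=1$ maintained by normalizing the weight vector $w$. The purpose is to compute the next principal component $v_{n+1}$.
   Formalization: The divisor λ_i² in C_n and f_n is corrected to λ_i; ''convex optimization problem'' is read as convex objective with all local maxima on the sphere global; ascent (step sizes of divergent sum) reaches the optimum iff its start is not orthogonal to all maximizers, which has probability one. *)

(* Defs.v *)
From HB Require Import structures.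
From mathcomp Require Import all_boot all_order all_algebra.
From mathcomp Require Import all_classical all_reals all_analysis.
Set Implicit Arguments.
Unset Strict Implicit.
Unset Printing Implicit Defensive.
Import Order.TTheory GRing.Theory Num.Theory.
Import numFieldNormedType.Exports.
Local Open Scope classical_set_scope.
Local Open Scope ring_scope.

(* Vectors are columns 'cV[R]_d; indices are 0-based, so v_1, ..., v_n are the
   v i with (i < n)%N and lambda_{n+1} is the value of lambda at index n.     *)

Section Deflation.
Context {R : realType} {d m : nat}.

Definition correlation (X : 'M[R]_(d, m)) : 'M[R]_d := X *m X^T.

(* Since |X^T v_i|^2 = v_i^T C v_i = lambda_i, the i-th term is
   lambda_i v_i v_i^T when divided by lambda_i; dividing by lambda_i^2 would
   leave v_i with eigenvalue lambda_i - 1 instead of 0. *)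
Definition deflated (C : 'M[R]_d) (v : 'I_d -> 'cV[R]_d) (lambda : 'I_d -> R)
    (n : nat) : 'M[R]_d :=
  C - \sum_(i < d | (i < n)%N)
        (lambda i)^-1 *: (C *m v i *m (v i)^T *m C).

Definition objective (X : 'M[R]_(d, m)) (v : 'I_d -> 'cV[R]_d)
    (lambda : 'I_d -> R) (n : nat) (w : 'cV[R]_d) : R :=
  let y := X^T *m w in
  (y^T *m y) 0 0 / 2 -
  \sum_(i < d | (i < n)%N)
     ((y^T *m (X^T *m v i)) 0 0) ^+ 2 / (2 * lambda i).

End Deflation.

Section Matrices.
Context {R : realType} {d : nat}.
Implicit Types (A : 'M[R]_d) (u w : 'cV[R]_d).

Definition orthonormal_family (v : 'I_d -> 'cV[R]_d) :=
  forall i j, ((v i)^T *m v j) 0 0 = (i == j)%:R.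

(* Column eigenvectors; the library's eigenspace is about row vectors. *)
Definition is_eigenvector A (a : R) u := u != 0 /\ A *m u = a *: u.

Definition quad A w : R := (w^T *m A *m w) 0 0.

Definition positive_semidefinite A := A^T = A /\ forall w, 0 <= quad A w.

Definition largest_eigenvalue A (a : R) :=
  eigenvalue A a /\ forall b, eigenvalue A b -> b <= a.

End Matrices.

Section Optimization.
Context {R : realType} {d : nat}.
Implicit Types (f : 'cV[R]_d -> R) (w : 'cV[R]_d) (S : set 'cV[R]_d).

(* The library norm on matrices is the max norm, hence the Euclidean one here. *)
Definition euclidean_norm w : R := Num.sqrt ((w^T *m w) 0 0).

Definition unit_sphere : set 'cV[R]_d := [set w | (w^T *m w) 0 0 = 1].

Definition normalize w : 'cV[R]_d := (euclidean_norm w)^-1 *: w.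

Definition global_maximizer f S w := S w /\ forall u, S u -> f u <= f w.

Definition local_maximizer f S w :=
  S w /\ \forall u \near w, S u -> f u <= f w.

Definition gradient f w : 'cV[R]_d := \col_i 'D_(delta_mx i 0) f w.

Definition gradient_ascent f (eta : nat -> R) (w : nat -> 'cV[R]_d) :=
  forall t, w t.+1 = normalize (w t + eta t *: gradient f (w t)).

(* Positive step sizes of infinite total length; constant steps qualify.
   With a finite total length the iterates may stop short of any optimum. *)
Definition admissible_steps (eta : nat -> R) :=
  (forall t, 0 < eta t) /\ series eta @ \oo --> +oo.

Definition reaches_global_maximum f S (w : nat -> 'cV[R]_d) :=
  exists2 l, global_maximizer f S l & w @ \oo --> l.

(* For the quadratic form of C_n: no component along the eigenspace of the
   largest eigenvalue, so gradient ascent can never leave its complement. *)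
Definition orthogonal_to_maximizers f S w :=
  forall u, global_maximizer f S u -> (u^T *m w) 0 0 = 0.

End Optimization.

Section RandomVectors.
Context {R : realType}.

(* Iterated integral: on Borel sets of d.-tuple R this is d-dimensional
   Lebesgue measure (the d-fold product of lebesgue_measure). *)
Fixpoint lebesgue_tuple (d : nat) : set (d.-tuple R) -> \bar R :=
  match d with
  | 0 => fun A => \d_[tuple] A
  | k.+1 => fun A =>
      (\int[lebesgue_measure]_(x in [set: R])
          lebesgue_tuple [set t : k.-tuple R | A (cons_tuple x t)])%E
  end.

(* A random vector whose law is absolutely continuous with respect to
   Lebesgue measure; a standard Gaussian one, once normalized, is uniform on
   the sphere. *)
Definition abs_continuous_vector (dO : measure_display)
    (Omega : measurableType dO) (P : probability Omega R) (d : nat)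
    (g : Omega -> 'cV[R]_d) :=
  (forall i, measurable_fun setT (fun o => g o i 0)) /\
  forall A : set (d.-tuple R), measurable A -> lebesgue_tuple A = 0%E ->
    P [set o | A [tuple g o i 0 | i < d]] = 0%E.

End RandomVectors.

(* Main.v *)
Require Import Defs.
From HB Require Import structures.
From mathcomp Require Import all_boot all_order all_algebra.
From mathcomp Require Import all_classical all_reals all_analysis.
From mathcomp Require Import measurable_realfun ring lra.
Set Implicit Arguments.
Unset Strict Implicit.
Unset Printing Implicit Defensive.
Import Order.TTheory GRing.Theory Num.Theory.
Import numFieldNormedType.Exports.
Local Open Scope classical_set_scope.
Local Open Scope ring_scope.

(** In the basis [v], the deflated matrix is diagonal with entries [mu i]
    ([0] for the first [n] directions, [lambda i] for the others), so a gradient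
    step multiplies the [i]-th coordinate by [1 + eta t * mu i] and then
    normalizes. Relative to the top eigenspace, every other coordinate is
    multiplied by [\prod_(s < t) (1 + eta s * mu i) / (1 + eta s * mu k)], which
    tends to [0] because the steps have infinite total length. The iterates thus
    converge to the normalized projection of the start onto the top eigenspace,
    provided that this projection is nonzero. Exceptional starts lie in a
    hyperplane, which is Lebesgue-null by Fubini. *)

(** * Euclidean inner product, norm and normalization of column vectors *)

Section InnerProduct.
Context {R : realType} {d : nat}.
Implicit Types (u w : 'cV[R]_d) (a : R).

Definition dot u w : R := (u^T *m w) 0 0.

Lemma dotE u w : dot u w = \sum_i u i 0 * w i 0.
Proof. by rewrite /dot mxE; apply: eq_bigr => i _; rewrite mxE. Qed.

Lemma dotC u w : dot u w = dot w u.
Proof. by rewrite !dotE; apply: eq_bigr => i _; rewrite mulrC. Qed.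

Lemma dotDr u w w' : dot u (w + w') = dot u w + dot u w'.
Proof. by rewrite /dot mulmxDr mxE. Qed.

Lemma dotZr a u w : dot u (a *: w) = a * dot u w.
Proof. by rewrite /dot -scalemxAr mxE. Qed.

Lemma dotDl u u' w : dot (u + u') w = dot u w + dot u' w.
Proof. by rewrite dotC dotDr !(dotC w). Qed.

Lemma dotZl a u w : dot (a *: u) w = a * dot u w.
Proof. by rewrite dotC dotZr dotC. Qed.

Lemma dotBr u w w' : dot u (w - w') = dot u w - dot u w'.
Proof. by rewrite -scaleN1r dotDr dotZr mulN1r. Qed.

Lemma dot0r u : dot u 0 = 0.
Proof. by rewrite /dot mulmx0 mxE. Qed.

Lemma dot_sumr I (s : seq I) (P : pred I) (F : I -> 'cV[R]_d) u :
  dot u (\sum_(i <- s | P i) F i) = \sum_(i <- s | P i) dot u (F i).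
Proof. by rewrite /dot mulmx_sumr summxE. Qed.

Lemma dot_ge0 u : 0 <= dot u u.
Proof. by rewrite dotE sumr_ge0// => i _; rewrite -expr2 sqr_ge0. Qed.

Lemma dot_eq0 u : (dot u u == 0) = (u == 0).
Proof.
apply/eqP/eqP => [|->]; last exact: dot0r.
rewrite dotE => /eqP; rewrite psumr_eq0; last by move=> i _; rewrite -expr2 sqr_ge0.
move=> /allP u0; apply/matrixP => i j; rewrite ord1 mxE; apply/eqP.
by have := u0 i (mem_index_enum _); rewrite /= mulf_eq0 orbb.
Qed.

Lemma dot_gt0 u : u != 0 -> 0 < dot u u.
Proof. by rewrite lt_def dot_ge0 andbT dot_eq0. Qed.

Lemma euclidean_norm_gt0 u : u != 0 -> 0 < euclidean_norm u.
Proof. by move=> u0; rewrite sqrtr_gt0 dot_gt0. Qed.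

Lemma normalize0 : normalize (0 : 'cV[R]_d) = 0.
Proof. exact: scaler0. Qed.

Lemma euclidean_normZ a u : 0 <= a ->
  euclidean_norm (a *: u) = a * euclidean_norm u.
Proof.
move=> a0; rewrite /euclidean_norm -!/(dot _ _) dotZl dotZr mulrA -expr2.
by rewrite sqrtrM ?sqr_ge0// sqrtr_sqr ger0_norm.
Qed.

Lemma normalizeZ a u : 0 < a -> normalize (a *: u) = normalize u.
Proof.
move=> a0; rewrite /normalize euclidean_normZ ?ltW// scalerA invfM.
by rewrite mulrAC mulVf ?mul1r// gt_eqF.
Qed.

Lemma unit_sphere_neq0 u : unit_sphere u -> u != 0.
Proof.
by move=> u1; rewrite -dot_eq0 /dot u1 oner_eq0.
Qed.

Lemma normalize_unit u : unit_sphere u -> normalize u = u.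
Proof.
by move=> u1; rewrite /normalize /euclidean_norm u1 sqrtr1 invr1 scale1r.
Qed.

Lemma unit_sphere_normalize u : u != 0 -> unit_sphere (normalize u).
Proof.
move=> u0; have uN := euclidean_norm_gt0 u0.
rewrite /unit_sphere/= -/(dot _ _) /normalize dotZl dotZr mulrA -expr2.
rewrite -[dot u u]sqr_sqrtr ?dot_ge0// -exprMn mulVf ?expr1n//.
by rewrite gt_eqF.
Qed.

Lemma euclidean_norm_continuous : continuous (@euclidean_norm R d).
Proof.
have dd : continuous (fun w : 'cV[R]_d => dot w w).
  rewrite (_ : (fun w => dot w w) = fun w : 'cV[R]_d => \sum_i w i 0 * w i 0);
    last by apply/funext => w; rewrite dotE.
  apply: continuous_big => [|i _ w]; first exact: add_continuous.
  have wi := @coord_continuous R d 1 i 0 w.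
  exact: (continuousM wi wi).
move=> u; apply: (continuous_comp (dd u)).
exact: sqrt_continuous.
Qed.

Lemma normalize_continuous u : u != 0 -> {for u, continuous (@normalize R d)}.
Proof.
move=> u0; have N0 : euclidean_norm u != 0 by rewrite gt_eqF// euclidean_norm_gt0.
exact: (cvgZ (cvgV N0 (@euclidean_norm_continuous u)) cvg_id).
Qed.

End InnerProduct.

(** * Coordinates in an orthonormal basis *)

Section OrthonormalBasis.
Context {R : realType} {d : nat} {v : 'I_d -> 'cV[R]_d}.
Hypothesis vON : orthonormal_family v.
Implicit Types (u w : 'cV[R]_d) (c : 'I_d -> R).

Lemma dot_basis i j : dot (v i) (v j) = (i == j)%:R.
Proof. exact: vON. Qed.

Lemma unit_sphere_basis i : unit_sphere (v i).
Proof. by rewrite /unit_sphere/= vON eqxx. Qed.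

(** The matrix [V] with columns [v i] is square, so its left inverse [V^T] is also a right inverse;
    the expansion is [V *m V^T *m w = w] read entrywise. *)
Lemma basis_expansion w : w = \sum_i dot (v i) w *: v i.
Proof.
pose V := \matrix_(i, j) v j i 0.
have VTV : V^T *m V = 1%:M.
  apply/matrixP => i j; rewrite !mxE -vON mxE.
  by apply: eq_bigr => k _; rewrite !mxE.
have VVT := mulmx1C VTV.
rewrite -[LHS]mul1mx -VVT -mulmxA; apply/matrixP => i j; rewrite ord1 summxE mxE.
apply: eq_bigr => k _; rewrite !mxE mulrC dotE; congr (_ * _).
by apply: eq_bigr => l _; rewrite !mxE.
Qed.

Lemma dot_lincomb c j : dot (v j) (\sum_i c i *: v i) = c j.
Proof.
rewrite dot_sumr (bigD1 j)//= dotZr dot_basis eqxx mulr1 big1 ?addr0// => i ij.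
by rewrite dotZr dot_basis eq_sym (negbTE ij) mulr0.
Qed.

Lemma parseval u w : dot u w = \sum_i dot (v i) u * dot (v i) w.
Proof.
rewrite {1}(basis_expansion w) dot_sumr; apply: eq_bigr => i _.
by rewrite dotZr (dotC u) mulrC.
Qed.

Lemma basis_ext u w : (forall i, dot (v i) u = dot (v i) w) -> u = w.
Proof.
move=> uw; rewrite (basis_expansion u) (basis_expansion w).
by under eq_bigr do rewrite uw.
Qed.

Lemma dot_basis_neq0 u : u != 0 -> exists i, dot (v i) u != 0.
Proof.
move=> u0; apply/existsP; apply: contraNT u0 => /existsPn u0.
by apply/eqP/basis_ext => i; rewrite dot0r; exact/eqP/negbNE/u0.
Qed.

End OrthonormalBasis.

(** * Matrices diagonal in an orthonormal basis: spectrum, and maximizers of the quadratic form on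
    the sphere *)

Section Diagonalized.
Context {R : realType} {d : nat} {v : 'I_d -> 'cV[R]_d}.
Hypothesis vON : orthonormal_family v.
Context {A : 'M[R]_d} {mu : 'I_d -> R}.
Hypothesis Av : forall i, A *m v i = mu i *: v i.
Implicit Types (u w : 'cV[R]_d).

Lemma basis_is_eigenvector i : is_eigenvector A (mu i) (v i).
Proof. by split; [exact: unit_sphere_neq0 (unit_sphere_basis vON i)|exact: Av]. Qed.

Lemma mulmx_basis w : A *m w = \sum_i (mu i * dot (v i) w) *: v i.
Proof.
rewrite {1}(basis_expansion vON w) mulmx_sumr; apply: eq_bigr => i _.
by rewrite -scalemxAr Av scalerA mulrC.
Qed.

Lemma dot_mulmx i w : dot (v i) (A *m w) = mu i * dot (v i) w.
Proof. by rewrite mulmx_basis dot_lincomb. Qed.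

Lemma bilinear_basis u w :
  dot u (A *m w) = \sum_i mu i * (dot (v i) u * dot (v i) w).
Proof.
by rewrite (parseval vON); apply: eq_bigr => i _; rewrite dot_mulmx mulrCA.
Qed.

Lemma quad_basis w : quad A w = \sum_i mu i * dot (v i) w ^+ 2.
Proof. by rewrite /quad -mulmxA -/(dot _ _) bilinear_basis. Qed.

(** The entries of [A] are values of its bilinear form on the standard basis, and that form is
    symmetric when written in the coordinates along [v]. *)
Lemma diagonalized_sym : A^T = A.
Proof.
have Ae i j : A i j = dot (delta_mx i 0) (A *m delta_mx j 0).
  rewrite -colE dotE (bigD1 i)//= !mxE !eqxx mul1r big1 ?addr0// => k ki.
  by rewrite !mxE (negbTE ki) mul0r.
apply/matrixP => i j; rewrite mxE !Ae !bilinear_basis.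
by apply: eq_bigr => k _; rewrite [X in _ * X]mulrC.
Qed.

(** Symmetry allows passing between row and column eigenvectors. An eigenvector for [b] has a
    nonzero coordinate along some [v i], and comparing that coordinate before and after applying [A]
    forces [b = mu i]. *)
Lemma diagonalized_eigenvalueP b : eigenvalue A b <-> exists i, b = mu i.
Proof.
split=> [/eigenvalueP[x xA x0]|[i ->]].
  have /(dot_basis_neq0 vON)[i xi] : x^T != 0 by rewrite trmx_eq0.
  exists i; apply: (mulIf xi); rewrite -dot_mulmx.
  by rewrite -{1}diagonalized_sym -trmx_mul xA linearZ/= dotZr.
apply/eigenvalueP; exists (v i)^T.
  by rewrite -{1}diagonalized_sym -trmx_mul Av linearZ.
by rewrite trmx_eq0; case: (basis_is_eigenvector i).
Qed.

Hypothesis mu_ge0 : forall i, 0 <= mu i.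

Lemma quad_ge0 w : 0 <= quad A w.
Proof. by rewrite quad_basis sumr_ge0// => i _; rewrite mulr_ge0// sqr_ge0. Qed.

Lemma diagonalized_psd : positive_semidefinite A.
Proof. by split; [exact: diagonalized_sym|exact: quad_ge0]. Qed.

Context {k : 'I_d}.
Hypothesis mu_le : forall i, mu i <= mu k.

Lemma diagonalized_largest_eigenvalue : largest_eigenvalue A (mu k).
Proof.
split; first by apply/diagonalized_eigenvalueP; exists k.
by move=> b /diagonalized_eigenvalueP[i ->].
Qed.

Lemma quad_basis_vector i : quad A (v i) = mu i.
Proof.
by rewrite /quad -mulmxA -/(dot _ _) Av dotZr dot_basis// eqxx mulr1.
Qed.

(** By [mu_le] the right-hand terms are nonnegative. This yields both the upper bound [mu k] and, at
    equality, the vanishing of every coordinate outside the top eigenspace. *)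
Lemma quad_gap w : unit_sphere w ->
  mu k - quad A w = \sum_i (mu k - mu i) * dot (v i) w ^+ 2.
Proof.
rewrite /unit_sphere/= -/(dot _ _) => w1.
under eq_bigr do rewrite mulrBl.
rewrite sumrB -quad_basis -mulr_sumr; congr (_ - _).
rewrite -[LHS]mulr1 -w1 (parseval vON); congr (_ * _).
Qed.

Lemma quad_le_max w : unit_sphere w -> quad A w <= mu k.
Proof.
move=> w1; rewrite -subr_ge0 quad_gap// sumr_ge0// => i _.
by rewrite mulr_ge0 ?sqr_ge0// subr_ge0.
Qed.

Lemma global_maximizer_quad w :
  global_maximizer (quad A) unit_sphere w <-> unit_sphere w /\ quad A w = mu k.
Proof.
split=> [[w1 wmax]|[w1 qw]]; split=> //; last first.
  by move=> u /quad_le_max; rewrite qw.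
apply/eqP; rewrite eq_le quad_le_max//= -(quad_basis_vector k).
exact: wmax (unit_sphere_basis vON k).
Qed.

Lemma global_maximizer_dot w i : global_maximizer (quad A) unit_sphere w ->
  mu i != mu k -> dot (v i) w = 0.
Proof.
move=> /global_maximizer_quad[w1 qw] mui.
have /eqP := quad_gap w1; rewrite qw subrr eq_sym psumr_eq0; last first.
  by move=> j _; rewrite mulr_ge0 ?sqr_ge0// subr_ge0.
move=> /allP /(_ i (mem_index_enum _)) /=.
by rewrite mulf_eq0 subr_eq0 eq_sym (negbTE mui) sqrf_eq0 => /eqP.
Qed.

Lemma global_maximizer_lincomb w : unit_sphere w ->
  (forall i, mu i != mu k -> dot (v i) w = 0) ->
  global_maximizer (quad A) unit_sphere w.
Proof.
move=> w1 w0; apply/global_maximizer_quad; split=> //.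
apply/eqP; rewrite eq_sym -subr_eq0 quad_gap// big1// => i _.
have [->|/w0->] := eqVneq (mu i) (mu k); first by rewrite subrr mul0r.
by rewrite expr0n mulr0.
Qed.

Lemma global_maximizer_basis i :
  mu i = mu k -> global_maximizer (quad A) unit_sphere (v i).
Proof.
by move=> mui; apply/global_maximizer_quad; rewrite quad_basis_vector; split=> //;
  exact: unit_sphere_basis.
Qed.

(** It suffices to test basis vectors: those with the top eigenvalue are maximizers, and every
    maximizer is a combination of them. *)
Lemma orthogonal_to_maximizersP w :
  orthogonal_to_maximizers (quad A) unit_sphere w <->
  forall i, mu i = mu k -> dot (v i) w = 0.
Proof.
split=> [wo i /global_maximizer_basis/wo//|w0 u umax].
rewrite -/(dot _ _) (parseval vON) big1// => i _.
have [/w0->|mui] := eqVneq (mu i) (mu k); first by rewrite mulr0.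
by rewrite (global_maximizer_dot umax mui) mul0r.
Qed.

End Diagonalized.

(** * The quadratic form of a symmetric matrix along a line, and its gradient *)

Section QuadraticForm.
Context {R : realType} {d : nat} {A : 'M[R]_d}.
Hypothesis A_sym : A^T = A.
Implicit Types (u w : 'cV[R]_d) (a : R).

Lemma dot_mulmx_sym u w : dot u (A *m w) = dot (A *m u) w.
Proof. by rewrite /dot trmx_mul A_sym mulmxA. Qed.

Lemma quadE w : quad A w = dot w (A *m w).
Proof. by rewrite /quad -mulmxA. Qed.

Lemma quadZ a w : quad A (a *: w) = a ^+ 2 * quad A w.
Proof. by rewrite !quadE -scalemxAr dotZl dotZr mulrA. Qed.

Lemma quad_normalize w : w != 0 -> quad A (normalize w) = quad A w / dot w w.
Proof.
by move=> w0; rewrite quadZ exprVn sqr_sqrtr ?dot_ge0// mulrC.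
Qed.

Lemma quadD_scale w u a :
  quad A (w + a *: u) = quad A w + a * (2 * dot u (A *m w)) + a ^+ 2 * quad A u.
Proof.
rewrite !quadE mulmxDr -scalemxAr !(dotDl, dotDr, dotZl, dotZr).
by rewrite [dot w (A *m u)]dot_mulmx_sym [dot (A *m w) u]dotC; ring.
Qed.

End QuadraticForm.

(** The difference quotient equals [b + h * c] for every nonzero [h]. *)
Lemma derive_quadratic {R : realType} {d : nat} (f : 'cV[R]_d -> R)
    (a u : 'cV[R]_d) (b c : R) :
  (forall h, f (a + h *: u) = f a + h * b + h ^+ 2 * c) -> 'D_u f a = b.
Proof.
move=> fE; rewrite /derive; apply: cvg_lim => //.
apply: (@cvg_trans _ ((fun h : R => b + h * c) @ 0^')).
  apply: near_eq_cvg; near=> h; rewrite /= [h *: u + a]addrC fE.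
  have h0 : h != 0 by near: h; exact: nbhs_dnbhs_neq.
  by rewrite /GRing.scale/=; field.
apply: cvg_within_filter.
have : (fun h : R => b + h * c) @ 0 --> b + 0 * c.
  exact: (cvgD (cvg_cst _) (cvgM cvg_id (cvg_cst _))).
by rewrite mul0r addr0.
Unshelve. all: by end_near. Qed.

Lemma gradient_half_quad {R : realType} {d : nat} (A : 'M[R]_d) w :
  A^T = A -> gradient (fun w => quad A w / 2) w = A *m w.
Proof.
move=> As; apply/matrixP => i j; rewrite ord1 mxE.
apply: (derive_quadratic (c := quad A (delta_mx i 0) / 2)) => h.
rewrite quadD_scale//.
have -> : dot (delta_mx i 0) (A *m w) = (A *m w) i 0.
  by rewrite dotE (bigD1 i)//= mxE !eqxx mul1r big1 ?addr0// => k ki;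
    rewrite mxE (negbTE ki) mul0r.
by field.
Qed.

(** * Convexity, and absence of spurious local maxima on the sphere *)

Section DiagonalizedOptimization.
Context {R : realType} {d : nat} {v : 'I_d -> 'cV[R]_d}.
Hypothesis vON : orthonormal_family v.
Context {A : 'M[R]_d} {mu : 'I_d -> R}.
Hypothesis Av : forall i, A *m v i = mu i *: v i.
Hypothesis mu_ge0 : forall i, 0 <= mu i.
Context {k : 'I_d}.
Hypothesis mu_le : forall i, mu i <= mu k.
Implicit Types (u w : 'cV[R]_d).

Lemma convex_quad : convex_function [set: convex_lmodType 'cV[R]_d] (quad A).
Proof.
move=> t x y _ _; set a := t%:num.
have a0 : 0 <= a by rewrite /a.
have a1 : 0 <= 1 - a by rewrite subr_ge0 /a.
rewrite [leLHS](_ : _ = quad A (a *: (x : 'cV[R]_d) + (1 - a) *: (y : 'cV[R]_d)))//.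
rewrite [leRHS](_ : _ = a * quad A x + (1 - a) * quad A y)//.
rewrite !(quad_basis vON Av) !mulr_sumr -big_split/=; apply: ler_sum => i _.
rewrite dotDr !dotZr -subr_ge0.
set p := dot _ _; set q := dot _ _.
(* The convexity defect of [p ^+ 2] is [a * (1 - a) * (p - q) ^+ 2], weighted here by [mu i]. *)
rewrite [X in 0 <= X](_ : _ = mu i * (a * (1 - a) * (p - q) ^+ 2)); last by ring.
by rewrite mulr_ge0// mulr_ge0 ?sqr_ge0// mulr_ge0.
Qed.

(* Moving along the great circle towards a top eigenvector that makes no obtuse
   angle with [w] increases the quadratic form, unless [w] is already optimal. *)
Lemma local_maximizer_quad w : local_maximizer (quad A) unit_sphere w ->
  global_maximizer (quad A) unit_sphere w.
Proof.
move=> [w1 wloc]; apply/(global_maximizer_quad vON Av mu_le); split=> //.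
have As := diagonalized_sym vON Av.
(* The sign makes [dot e w] nonnegative; [- v k] is as good a top eigenvector as [v k]. *)
pose s : R := if 0 <= dot (v k) w then 1 else -1.
pose e := s *: v k.
have ss : s * s = 1 by rewrite /s; case: ifP => _; rewrite ?mul1r// mulrNN mulr1.
have ee : dot e e = 1 by rewrite dotZl dotZr dot_basis// eqxx mulr1.
have Ae : A *m e = mu k *: e by rewrite -scalemxAr Av !scalerA mulrC.
have ew : 0 <= dot e w.
  rewrite dotZl /s; case: (leP 0 (dot (v k) w)) => [|/ltW]; first by rewrite mul1r.
  by rewrite mulN1r oppr_ge0.
clearbody e; have w0 := unit_sphere_neq0 w1.
have path_cvg : (fun t : R => normalize (w + t *: e)) @ 0^'+ --> w.
  apply: cvg_at_right_filter.
  have lin : (fun t : R => w + t *: e) @ 0 --> w.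
    rewrite [X in _ --> X](_ : w = w + 0 *: e); last by rewrite scale0r addr0.
    exact: (cvgD (cvg_cst _) (cvgZ cvg_id (cvg_cst _))).
  rewrite -[X in _ --> X](normalize_unit w1).
  exact: (cvg_comp _ _ lin (normalize_continuous w0)).
have : \forall t \near 0^'+, 0 < t /\
    (unit_sphere (normalize (w + t *: e)) ->
     quad A (normalize (w + t *: e)) <= quad A w).
  near=> t; split; first by [].
  by near: t; exact: (path_cvg _ wloc).
move=> /filter_ex[t [t0]].
have ut : w + t *: e != 0.
  apply/eqP => /(congr1 (dot e)); rewrite dot0r dotDr dotZr ee; lra.
move=> /(_ (unit_sphere_normalize ut)).
rewrite quad_normalize// ler_pdivrMr ?dot_gt0// quadD_scale//.
rewrite dot_mulmx_sym// Ae dotZl [quad A e]quadE Ae dotZr ee.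
rewrite dotDl !dotDr !dotZl !dotZr ee (dotC w e).
have -> : dot w w = 1 by exact: w1.
move=> qle; apply/eqP; rewrite eq_le (quad_le_max vON Av mu_le)//=.
(* With [p = 2 * (t * dot e w) + t * t], the numerator grows by [mu k * p] and the squared norm by
   [p]. Local maximality thus gives [mu k * p <= quad A w * p], and [p] cancels. *)
have p0 : 0 < 2 * (t * dot e w) + t * t.
  by rewrite ltr_wpDl ?mulr_gt0// mulr_ge0// mulr_ge0// ltW.
rewrite -(ler_pM2r p0); nra.
Unshelve. all: by end_near. Qed.

End DiagonalizedOptimization.

(* If the products stayed above [l > 0], the ratios would tend to 1, so that the
   steps would eventually be bounded and then dominated by a constant times the
   telescoping decrements of the products, contradicting divergence. *)
Lemma damping_cvg0 {R : realType} (eta : nat -> R) (a b : R) :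
  admissible_steps eta -> 0 <= a -> a < b ->
  \prod_(s < t) ((1 + eta s * a) / (1 + eta s * b)) @[t --> \oo] --> 0.
Proof.
move=> [eta_gt0 eta_dvg] a0 ab.
set P := fun t : nat => _; have b0 : 0 < b by exact: le_lt_trans ab.
have denb t : 0 < 1 + eta t * b by rewrite addr_gt0// mulr_gt0.
have dena t : 0 < 1 + eta t * a by rewrite ltr_pwDl// mulr_ge0// ltW.
have P_gt0 t : 0 < P t by apply: prodr_gt0 => s _; rewrite divr_gt0.
have PS t : P t.+1 = P t * ((1 + eta t * a) / (1 + eta t * b)).
  by rewrite /P big_ord_recr.
have PB t : P t - P t.+1 = P t * (eta t * (b - a) / (1 + eta t * b)).
  by rewrite PS; field; rewrite gt_eqF.
have P_noninc : nonincreasing_seq P.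
  apply/nonincreasing_seqP => t; rewrite -subr_ge0 PB.
  by rewrite mulr_ge0 ?ltW// divr_gt0// mulr_gt0// subr_gt0.
have P_cvg : cvgn P.
  apply: nonincreasing_is_cvgn => //; exists 0 => _ [t _ <-]; exact: ltW.
have [l Pl] : exists l : R, P @ \oo --> l by exists (limn P).
have l_le t : l <= P t by rewrite -(cvg_lim _ Pl)//; exact: nonincreasing_cvgn_ge.
have : 0 <= l by rewrite -(cvg_lim _ Pl)//; apply: limr_ge => //; near=> t; exact: ltW.
rewrite le_eqVlt => /predU1P[->//|l0]; exfalso.
pose K := 2 / (l * (b - a)).
have K0 : 0 < K by rewrite divr_gt0// mulr_gt0// subr_gt0.
have decr : P t - P t.+1 @[t --> \oo] --> 0.
  rewrite -[X in _ --> X](subrr l); apply: cvgB => //.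
  by rewrite (cvg_shiftS P).
have e0 : 0 < l * (b - a) / (2 * b) by rewrite divr_gt0 ?mulr_gt0 ?subr_gt0.
(* A decrement is at least [l * (eta t * (b - a) / (1 + eta t * b))], so staying under this
   threshold forces [eta t * b < 1]. The denominator is then below 2, which explains the constant
   [K]. *)
have [N _ HN] : \forall t \near \oo, P t - P t.+1 < l * (b - a) / (2 * b).
  exact: (cvgr_lt _ decr _ e0).
have step t : (N <= t)%N -> eta t <= K * (P t - P t.+1).
  move=> /HN /= dlt.
  have lPB : l * (eta t * (b - a) / (1 + eta t * b)) <= P t - P t.+1.
    by rewrite PB ler_wpM2r// ltW// divr_gt0// mulr_gt0// subr_gt0.
  have := le_lt_trans lPB dlt.
  rewrite [X in X < _](_ : _ = l * (b - a) * (eta t / (1 + eta t * b))); last by ring.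
  have lba : 0 < l * (b - a) by rewrite mulr_gt0// subr_gt0.
  rewrite ltr_pM2l// ltr_pdivrMr// mulrC ltr_pdivlMr ?mulr_gt0// => small.
  rewrite -ler_pdivrMl//; apply: le_trans lPB.
  rewrite [X in X <= _](_ : _ = l * (b - a) * eta t * 2^-1); last first.
    by rewrite /K; field; rewrite subr_eq0 !gt_eqF.
  rewrite [X in _ <= X](_ : _ = l * (b - a) * eta t * (1 + eta t * b)^-1); last by ring.
  rewrite ler_pM2l ?mulr_gt0 ?subr_gt0// lef_pV2 ?posrE//; lra.
(* The decrements telescope, so the partial sums stay below [series eta N + K * P N]. *)
have bounded j : series eta (N + j)%N <= series eta N + K * (P N - P (N + j)%N).
  elim: j => [|j IH]; first by rewrite addn0 subrr mulr0 addr0.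
  rewrite addnS seriesSr; have := step (N + j)%N (leq_addr _ _); lra.
move/cvgryPge: eta_dvg => /(_ (series eta N + K * P N + 1)) eta_big.
have [t [Nt]] : exists t, (N <= t)%N /\ series eta N + K * P N + 1 <= series eta t.
  apply: (@filter_ex _ \oo); near=> t; split; near: t => //; exact: nbhs_infty_ge.
have := bounded (t - N)%N; rewrite subnKC//.
have := mulr_gt0 K0 (P_gt0 t); lra.
Unshelve. all: by end_near. Qed.

Lemma cvg_sumr {R : realType} {V : normedModType R} (I : Type) (s : seq I)
    (f : I -> nat -> V) (l : I -> V) :
  (forall i, f i t @[t --> \oo] --> l i) ->
  \sum_(i <- s) f i t @[t --> \oo] --> \sum_(i <- s) l i.
Proof.
move=> fl; elim: s => [|i s IH].
  rewrite big_nil; under eq_fun do rewrite big_nil; exact: cvg_cst.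
by rewrite big_cons; under eq_fun do rewrite big_cons; exact: cvgD.
Qed.

(** * Normalized gradient ascent in eigencoordinates *)

Section Ascent.
Context {R : realType} {d : nat} {v : 'I_d -> 'cV[R]_d}.
Hypothesis vON : orthonormal_family v.
Context {A : 'M[R]_d} {mu : 'I_d -> R}.
Hypothesis Av : forall i, A *m v i = mu i *: v i.
Hypothesis mu_ge0 : forall i, 0 <= mu i.
Context {k : 'I_d}.
Hypothesis mu_le : forall i, mu i <= mu k.
Context {eta : nat -> R} {w : nat -> 'cV[R]_d}.
Hypothesis eta_admissible : admissible_steps eta.
Hypothesis w0_unit : unit_sphere (w 0%N).
Hypothesis w_ascent : forall t, w t.+1 = normalize (w t + eta t *: (A *m w t)).

(* The iterate before normalization, rescaled so that its components along the
   top eigenspace stay constant. *)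
Definition rescaled (t : nat) : 'cV[R]_d :=
  \sum_i (dot (v i) (w 0%N) *
          \prod_(s < t) ((1 + eta s * mu i) / (1 + eta s * mu k))) *: v i.

Let factor_gt0 i s : 0 < 1 + eta s * mu i.
Proof. by rewrite ltr_pwDl// mulr_ge0// ltW//; case: eta_admissible. Qed.

Lemma dot_rescaled i t : dot (v i) (rescaled t) =
  dot (v i) (w 0%N) * \prod_(s < t) ((1 + eta s * mu i) / (1 + eta s * mu k)).
Proof. exact: dot_lincomb. Qed.

Lemma rescaled_neq0 t : rescaled t != 0.
Proof.
have [i wi] := dot_basis_neq0 vON (unit_sphere_neq0 w0_unit).
apply: contraNneq wi => r0.
have := dot_rescaled i t; rewrite r0 dot0r => /esym/eqP.
rewrite mulf_eq0 => /orP[//|/eqP p0].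
suff : 0 < \prod_(s < t) ((1 + eta s * mu i) / (1 + eta s * mu k)).
  by rewrite p0 ltxx.
by apply: prodr_gt0 => s _; rewrite divr_gt0.
Qed.

(** Normalization ignores positive factors, so it can be postponed to the end: each step produces a
    positive multiple of [rescaled t.+1]. *)
Lemma ascent_normalize_rescaled t : w t = normalize (rescaled t).
Proof.
elim: t => [|t IH].
  rewrite [rescaled _](_ : _ = w 0%N) ?normalize_unit//.
  by apply: (basis_ext vON) => i; rewrite dot_rescaled big_ord0 mulr1.
have N0 : 0 < (euclidean_norm (rescaled t))^-1.
  by rewrite invr_gt0 euclidean_norm_gt0// rescaled_neq0.
rewrite w_ascent {}IH [normalize (rescaled t)]/normalize.
set a := _^-1 in N0 *.
rewrite (_ : a *: _ + _ = (a * (1 + eta t * mu k)) *: rescaled t.+1).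
  by rewrite normalizeZ// mulr_gt0.
apply: (basis_ext vON) => i.
rewrite dotDr !dotZr (dot_mulmx vON Av) dotZr !dot_rescaled big_ord_recr/=.
by field; rewrite gt_eqF.
Qed.

Lemma ascent_reaches_maximum :
  reaches_global_maximum (quad A) unit_sphere w <->
  ~ orthogonal_to_maximizers (quad A) unit_sphere (w 0%N).
Proof.
have orthP := orthogonal_to_maximizersP vON Av mu_le (w 0%N).
split=> [[l lmax wl] /orthP w0_orth|w0_north].
  have [l1 _] := lmax.
  (* Top coordinates of the iterates stay zero when they start at zero, and the other coordinates of
     a maximizer vanish. The limit would be the zero vector, which is not on the sphere. *)
  have l_orth i : dot (v i) l = 0.
    have [mui|] := eqVneq (mu i) (mu k); last exact: (global_maximizer_dot vON Av mu_le).
    have : dot (v i) (w t) @[t --> \oo] --> dot (v i) l.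
      rewrite dotE; under eq_fun do rewrite dotE.
      apply: cvg_sumr => j; apply: cvgM; first exact: cvg_cst.
      exact: (cvg_comp _ _ wl (@coord_continuous R d 1 j 0 l)).
    under eq_fun do rewrite ascent_normalize_rescaled dotZr dot_rescaled
      w0_orth// mul0r mulr0.
    by move=> /cvg_lim <-//; rewrite lim_cst.
  have [i] := dot_basis_neq0 vON (unit_sphere_neq0 l1).
  by rewrite l_orth eqxx.
have [i [mui wi]] : exists i, mu i = mu k /\ dot (v i) (w 0%N) <> 0.
  apply: contrapT => no; apply/w0_north/orthP => i mui.
  by apply: contrapT => wi; apply: no; exists i.
(* [l] is the orthogonal projection of the start onto the top eigenspace, nonzero because of the
   coordinate [i] found above. *)
pose c i := dot (v i) (w 0%N) * (mu i == mu k)%:R.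
pose l := \sum_i c i *: v i.
have l0 : l != 0.
  apply/eqP => /(congr1 (dot (v i))); rewrite dot_lincomb// dot0r /c mui eqxx.
  by rewrite mulr1.
have rescaled_cvg : rescaled t @[t --> \oo] --> l.
  apply: cvg_sumr => j; apply: cvgZ; last exact: cvg_cst.
  apply: cvgM; first exact: cvg_cst.
  have [muj|muj] := eqVneq (mu j) (mu k); last first.
    by apply: damping_cvg0 => //; rewrite lt_neqAle muj mu_le.
  under eq_fun do (rewrite big1; last by move=> s _; rewrite muj divff// gt_eqF).
  exact: cvg_cst.
exists (normalize l).
  apply: (global_maximizer_lincomb vON Av mu_le).
    exact: unit_sphere_normalize.
  by move=> j muj; rewrite dotZr dot_lincomb// /c (negbTE muj) !mulr0.
rewrite (_ : w = normalize \o rescaled); last first.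
  by apply/funext => t; exact: ascent_normalize_rescaled.
exact: (cvg_comp _ _ rescaled_cvg (normalize_continuous l0)).
Qed.

End Ascent.

(** * Hyperplanes are Lebesgue-null *)

Section HyperplaneNull.
Context {R : realType}.

Lemma lebesgue_tuple0 n : @lebesgue_tuple R n set0 = 0%E.
Proof.
elim: n => [|n IH] /=; first by rewrite diracE in_set0.
by rewrite integral0_eq// => x _; exact: IH.
Qed.

(** Induction by slicing along the first coordinate: fixing it shifts the right-hand side, hence the
    arbitrary [b], and shifts the coefficients, hence their indexing by [nat]. If a later
    coefficient is nonzero, all slices are null by induction; otherwise only the slice at [b / a 0]
    is nonempty, and one point has measure zero. *)
Lemma hyperplane_null n (a : nat -> R) (b : R) : (exists2 i, (i < n)%N & a i != 0) ->
  lebesgue_tuple [set t : n.-tuple R | \sum_(i < n) a i * tnth t i = b] = 0%E.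
Proof.
elim: n a b => [|n IH] a b; first by case.
move=> [i]; rewrite ltnS => lin ai /=.
have slice x : [set t : n.-tuple R | [set t0 : n.+1.-tuple R |
      \sum_(i < n.+1) a i * tnth t0 i = b] (cons_tuple x t)] =
    [set t : n.-tuple R | \sum_(i < n) a i.+1 * tnth t i = b - a 0%N * x].
  have sumE (t : n.-tuple R) : \sum_(i < n.+1) a i * tnth (cons_tuple x t) i =
      a 0%N * x + \sum_(i < n) a i.+1 * tnth t i.
    rewrite big_ord_recl tnth0; congr (_ + _).
    by apply: eq_bigr => j _; rewrite tnthS.
  apply/seteqP; split=> t /=; rewrite sumE; [move=> <-|move=> ->].
    by rewrite addrAC subrr add0r.
  by rewrite addrC subrK.
under eq_integral do rewrite slice.
have [[j jn aj]|tail0] := pselect (exists2 j, (j < n)%N & a j.+1 != 0).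
  by rewrite integral0_eq// => x _; apply: (IH (fun i => a i.+1)); exists j.
have a_tail j : (j < n)%N -> a j.+1 = 0.
  by move=> jn; apply/eqP/negPn/negP => aj; apply: tail0; exists j.
have a0 : a 0%N != 0.
  by case: i lin ai => [//|i] lin; rewrite a_tail ?eqxx.
pose x0 := b / a 0%N.
pose c : \bar R := lebesgue_tuple [set: n.-tuple R].
(* The volume [c] of the exceptional slice may be infinite; its product with the zero measure of a
   point is still [0] in the extended reals. *)
transitivity (\int[lebesgue_measure]_x ((cst c) \_ [set x0]) x)%E.
  apply: eq_integral => x _; rewrite patchE.
  have sum0 (t : n.-tuple R) : \sum_(i < n) a i.+1 * tnth t i = 0.
    by apply: big1 => j _; rewrite a_tail ?mul0r.
  case: ifPn => [|/negP xx0].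
    rewrite inE/= => ->; congr lebesgue_tuple; apply/seteqP; split=> t //= _.
    by rewrite sum0 /x0 mulrC divfK ?subrr.
  transitivity (@lebesgue_tuple R n set0); last exact: lebesgue_tuple0.
  congr lebesgue_tuple; apply/seteqP; split=> t //=.
  rewrite sum0 => /esym/eqP; rewrite subr_eq0 => /eqP bE; apply: xx0.
  by rewrite inE/= /x0 bE mulrAC divff ?mul1r.
rewrite -integral_mkcond integral_cst//.
by rewrite [X in (_ * X)%E](lebesgue_measure_set1 x0) mule0.
Qed.

Lemma measurable_hyperplane n (a : nat -> R) (b : R) :
  measurable [set t : n.-tuple R | \sum_(i < n) a i * tnth t i = b].
Proof.
have mf : measurable_fun [set: n.-tuple R] (fun t => \sum_(i < n) a i * tnth t i).
  apply: measurable_sum => i; apply: measurable_funM; first exact: measurable_cst.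
  exact: measurable_tnth.
by have := mf measurableT [set b] (measurable_set1 b); rewrite setTI.
Qed.

Context {dO : measure_display} {Omega : measurableType dO}.
Context {P : probability Omega R} {d : nat} {g : Omega -> 'cV[R]_d}.
Hypothesis g_ac : abs_continuous_vector P g.

Lemma abs_continuous_hyperplane (u : 'cV[R]_d) : u != 0 ->
  P.-negligible [set o | dot u (g o) = 0].
Proof.
have [mg gP] := g_ac; move=> u0.
(* The entries of [u] are extended by zero to all of [nat], the form required by
   [hyperplane_null]. *)
pose a (i : nat) : R := if insub i is Some j then u j 0 else 0.
have aE (i : 'I_d) : a i = u i 0 by rewrite /a valK.
exists [set o | dot u (g o) = 0]; split => //.
  have mf : measurable_fun setT (fun o => dot u (g o)).
    rewrite (_ : (fun o => _) = fun o => \sum_i u i 0 * g o i 0).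
      apply: measurable_sum => i; apply: measurable_funM; first exact: measurable_cst.
      exact: mg.
    by apply/funext => o; rewrite dotE.
  by have := mf measurableT [set 0] (measurable_set1 0); rewrite setTI.
rewrite -(gP _ (measurable_hyperplane a 0)).
  congr (P _); apply/funext => o /=; congr (_ = _); rewrite dotE.
  by apply: eq_bigr => i _; rewrite tnth_mktuple aE.
apply: hyperplane_null.
have /existsP[i ui] : [exists i, u i 0 != 0].
  apply: contraNT u0 => /existsPn u0; apply/eqP/matrixP => i j.
  by rewrite ord1 mxE; exact/eqP/negbNE/u0.
by exists i => //; rewrite aE.
Qed.

End HyperplaneNull.

(** * The deflated correlation matrix, its objective and its spectrum *)

Section DeflatedCorrelation.
Context {R : realType} {d m n : nat} {X : 'M[R]_(d, m)}.
Context {v : 'I_d -> 'cV[R]_d} {lambda : 'I_d -> R}.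
Local Notation C := (correlation X).
Local Notation Cn := (deflated C v lambda n).
Implicit Types (p q u w : 'cV[R]_d).

Lemma correlation_sym : C^T = C.
Proof. by rewrite /correlation trmx_mul trmxK. Qed.

Lemma dot_correlation u w : (X^T *m u)^T *m (X^T *m w) = u^T *m (C *m w).
Proof. by rewrite trmx_mul trmxK !mulmxA. Qed.

Lemma mulmx_rank1 p q w : p *m q^T *m w = dot q w *: p.
Proof. by rewrite -mulmxA [q^T *m w]mx11_scalar mul_mx_scalar. Qed.

Lemma mulmx_deflated w : Cn *m w = C *m w -
  \sum_(i < d | (i < n)%N) ((lambda i)^-1 * dot (C *m v i) w) *: (C *m v i).
Proof.
rewrite /deflated mulmxBl mulmx_suml; congr (_ - _); apply: eq_bigr => i _.
rewrite -scalemxAl -scalerA; congr (_ *: _).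
by rewrite -mulmx_rank1 trmx_mul correlation_sym !mulmxA.
Qed.

Lemma objectiveE w : objective X v lambda n w = quad Cn w / 2.
Proof.
rewrite quadE mulmx_deflated /objective dot_correlation -/(dot _ _).
rewrite dotBr mulrBl dot_sumr mulr_suml; congr (_ - _).
apply: eq_bigr => i _.
rewrite dot_correlation -/(dot _ _) dotZr (dotC (C *m v i)) invfM.
ring.
Qed.

Hypothesis vON : orthonormal_family v.
Hypothesis v_eigen : forall i, is_eigenvector C (lambda i) (v i).

(** [lambda i] is the squared norm of [X^T *m v i]. *)
Lemma correlation_eigenvalue_ge0 i : 0 <= lambda i.
Proof.
have [_ Cv] := v_eigen i.
have -> : lambda i = dot (X^T *m v i) (X^T *m v i).
  by rewrite /dot dot_correlation Cv -/(dot _ _) dotZr dot_basis// eqxx mulr1.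
exact: dot_ge0.
Qed.

Hypothesis lambda_gt0 : forall i : 'I_d, (i < n)%N -> 0 < lambda i.

(** Orthonormality leaves at most the term [i = j] of the sum; for [j < n] it equals
    [lambda j *: v j], since [lambda j] is invertible, and cancels [C *m v j]. *)
Lemma deflated_basis j :
  Cn *m v j = (if (j < n)%N then 0 else lambda j) *: v j.
Proof.
have Cv i : C *m v i = lambda i *: v i by case: (v_eigen i).
rewrite mulmx_deflated Cv.
under eq_bigr do rewrite Cv dotZl dot_basis//.
case: ifPn => jn; last first.
  rewrite big1 ?subr0// => i iN.
  have /negbTE-> : i != j by apply: contraNneq jn => <-.
  by rewrite !mulr0 scale0r.
rewrite (bigD1 j)//= eqxx mulr1 mulVf ?gt_eqF ?lambda_gt0// scale1r.
rewrite big1 ?addr0 ?subrr ?scale0r// => i /andP[_ /negbTE->].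
by rewrite !mulr0 scale0r.
Qed.

End DeflatedCorrelation.

Theorem mainTheorem1 (R : realType) (d m n : nat) (X : 'M[R]_(d, m))
    (v : 'I_d -> 'cV[R]_d) (lambda : 'I_d -> R)
    (zero_mean : \sum_(j < m) col j X = 0)
    (v_orthonormal : orthonormal_family v)
    (v_eigen : forall i, is_eigenvector (correlation X) (lambda i) (v i))
    (lambda_sorted : forall i j : 'I_d, (i <= j)%N -> lambda j <= lambda i)
    (n_gt0 : (1 <= n)%N) (n_lt_d : (n < d)%N)
    (lambda_gt0 : forall i : 'I_d, (i < n)%N -> 0 < lambda i) :
  let Cn := deflated (correlation X) v lambda n in
  let fn := objective X v lambda n in
  let lambda_next := lambda (Ordinal n_lt_d) in
  [/\ Cn^T = Cn,
      forall i : 'I_d,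
        is_eigenvector Cn (if (i < n)%N then 0 else lambda i) (v i),
      largest_eigenvalue Cn lambda_next &
      positive_semidefinite Cn]
  /\
  (* the problem of maximizing quad Cn on the unit sphere *)
  (convex_function [set: convex_lmodType 'cV[R]_d] (quad Cn) /\
   forall w, local_maximizer (quad Cn) unit_sphere w ->
             global_maximizer (quad Cn) unit_sphere w)
  /\
  (forall w, gradient fn w = Cn *m w)
  /\
  (* gradient ascent reaches the optimum, except from exceptional starts *)
  (forall (eta : nat -> R) (w : nat -> 'cV[R]_d),
     admissible_steps eta -> unit_sphere (w 0%N) -> gradient_ascent fn eta w ->
     (reaches_global_maximum (quad Cn) unit_sphere w <->
      ~ orthogonal_to_maximizers (quad Cn) unit_sphere (w 0%N)))
  /\
  (* at an eigenvector with vanishing gradient the ascent does not move; it is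
     an exceptional start unless Cn = 0, when every unit vector is optimal *)
  (forall i : 'I_d, gradient fn (v i) = 0 ->
     (forall (eta : nat -> R) (w : nat -> 'cV[R]_d),
        w 0%N = v i -> gradient_ascent fn eta w -> forall t, w t = v i) /\
     (Cn <> 0 -> orthogonal_to_maximizers (quad Cn) unit_sphere (v i)))
  /\
  (* random starting vectors *)
  (forall (dO : measure_display) (Omega : measurableType dO)
     (P : probability Omega R) (g : Omega -> 'cV[R]_d),
     abs_continuous_vector P g ->
     [/\ P.-negligible [set o | exists i : 'I_d,
           gradient fn (v i) = 0 /\ normalize (g o) = v i],
         P.-negligible [set o |
           orthogonal_to_maximizers (quad Cn) unit_sphere (normalize (g o))] &
         {ae P, forall o, forall (eta : nat -> R) (w : nat -> 'cV[R]_d),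
           admissible_steps eta -> w 0%N = normalize (g o) ->
           gradient_ascent fn eta w ->
           reaches_global_maximum (quad Cn) unit_sphere w}]).
Proof.
move=> Cn fn lambda_next.
pose mu (i : 'I_d) := if (i < n)%N then 0 else lambda i.
pose k := Ordinal n_lt_d.
have lambda_ge0 := correlation_eigenvalue_ge0 v_orthonormal v_eigen.
have mu_ge0 i : 0 <= mu i by rewrite /mu; case: ifP.
have muk : mu k = lambda k by rewrite /mu ltnn.
have mu_le i : mu i <= mu k.
  by rewrite muk /mu; case: ltnP => // ni; exact: lambda_sorted.
have Cv i : Cn *m v i = mu i *: v i.
  exact: (deflated_basis v_orthonormal v_eigen lambda_gt0).
have Cn_sym := diagonalized_sym v_orthonormal Cv.
have grad w : gradient fn w = Cn *m w.
  rewrite -(gradient_half_quad _ Cn_sym); congr gradient.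
  by apply/funext => u; exact: objectiveE.
have orthP w := orthogonal_to_maximizersP v_orthonormal Cv mu_le w.
have reach eta w : admissible_steps eta -> unit_sphere (w 0%N) ->
    gradient_ascent fn eta w ->
    (reaches_global_maximum (quad Cn) unit_sphere w <->
     ~ orthogonal_to_maximizers (quad Cn) unit_sphere (w 0%N)).
  move=> eta_adm w0 w_asc.
  apply: (ascent_reaches_maximum v_orthonormal Cv mu_ge0 mu_le eta_adm) => //.
  by move=> t; rewrite w_asc grad.
split; [|split; [|split; [|split; [|split]]]] => //.
- split=> //.
  + by move=> i; exact: (basis_is_eigenvector v_orthonormal Cv).
  + rewrite /lambda_next -/k -muk.
    exact: (diagonalized_largest_eigenvalue v_orthonormal Cv).
  + exact: (diagonalized_psd v_orthonormal Cv).
- split; first exact: (convex_quad v_orthonormal Cv).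
  exact: (local_maximizer_quad v_orthonormal Cv).
- move=> i; rewrite grad => Cvi0; split=> [eta w w0 w_asc|Cn0].
    elim=> [//|t IH]; rewrite w_asc IH grad Cvi0 scaler0 addr0.
    exact/normalize_unit/unit_sphere_basis.
  apply/orthP => j muj; rewrite dot_basis//; case: eqVneq => // ji.
  (* Here [v i] would itself be a top eigenvector; a vanishing gradient makes its eigenvalue zero,
     hence all eigenvalues zero and [Cn = 0]. *)
  have mui : mu i = 0.
    have vv : dot (v i) (v i) = 1 by rewrite dot_basis// eqxx.
    by rewrite -[mu i]mulr1 -vv -dotZr -Cv Cvi0 dot0r.
  exfalso; apply: Cn0.
  have mu0 l : mu l = 0.
    by apply/eqP; rewrite eq_le mu_ge0 andbT -mui -ji muj mu_le.
  have Cn0 (w : 'cV[R]_d) : Cn *m w = 0.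
    rewrite (mulmx_basis v_orthonormal Cv) big1// => l _.
    by rewrite mu0 mul0r scale0r.
  apply/matrixP => a b; have /matrixP/(_ a 0) := Cn0 (delta_mx b 0).
  by rewrite -colE !mxE.
- move=> dO Omega P g g_ac.
  have v0 i : v i != 0 by case: (v_eigen i).
  have null i : P.-negligible [set o | dot (v i) (g o) = 0].
    exact: abs_continuous_hyperplane.
  have normalize_dot0 i o : dot (v i) (normalize (g o)) = 0 -> dot (v i) (g o) = 0.
    rewrite dotZr => /eqP; rewrite mulf_eq0 invr_eq0 => /orP[|/eqP//].
    have [->|/euclidean_norm_gt0 /gt_eqF->//] := eqVneq (g o) 0.
    by rewrite dot0r.
  have orth_null : P.-negligible [set o |
      orthogonal_to_maximizers (quad Cn) unit_sphere (normalize (g o))].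
    apply: negligibleS (null k) => o /orthP/(_ k erefl); exact: normalize_dot0.
  split=> //.
    (* If the normalized vector is [v i], all its other coordinates vanish. Since [1 <= n], the
       indices [0] and [n] differ, so at least one of them is not [i], and two hyperplanes cover the
       event for every [i]. *)
    have d_gt0 : (0 < d)%N by rewrite (leq_ltn_trans _ n_lt_d).
    pose z := Ordinal d_gt0.
    have zk : z != k by rewrite -val_eqE/= eq_sym -lt0n.
    apply: negligibleS (negligibleU (null z) (null k)) => o [i [_ gi]].
    have dij j : j != i -> dot (v j) (g o) = 0.
      by move=> ji; apply: normalize_dot0; rewrite gi dot_basis// (negbTE ji).
    have [zi|zi] := eqVneq z i; [right|left]; apply: dij => //.
    by rewrite -zi eq_sym.
  apply: negligibleS orth_null => o /=; apply: contra_notP.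
  move=> north eta w eta_adm w0 w_asc.
  have w0_unit : unit_sphere (w 0%N).
    (* A zero sample normalizes to zero, which is orthogonal to everything and so already excluded
       by [north]. *)
    rewrite w0; apply: unit_sphere_normalize; apply/eqP => g0; apply: north.
    by rewrite g0 normalize0 => u _; exact: dot0r.
  by apply/(reach _ _ eta_adm w0_unit w_asc); rewrite w0.
Qed.
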